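(* Let $a>1$ and for $\ell=0,1,\dots$ let $\Phi_{\ell,a}(z)=\mathcal{B}\left(\frac{\mathtt{H}_\ell}{\sqrt{\ell!}}\right)(z)$, where $\mathtt{H}_\ell(x)=h_\ell(x)e^{iax}$. Let $T_a=\frac{\partial}{\partial z}-\frac{ia}{\sqrt2}$. Then for every $\ell\geq1$ and $z\in\mathbb{C}$, $T_a\Phi_{\ell,a}(z)=\Phi_{\ell-1,a}(z)$, i.e. $(\Phi_{\ell,a})_{\ell\ge0}$ is an Appell system with respect to $T_a$.
   Context: $h_\ell(x)=(2^\ell\ell!\sqrt\pi)^{-1/2}H_\ell(x)e^{-x^2/2}$ are the normalized Hermite functions ($H_\ell$ the Hermite polynomials). $\mathcal{B}(\varphi)(z)=\pi^{-1/4}\int_{\mathbb{R}}e^{-\frac12(z^2+x^2)+\sqrt2 zx}\varphi(x)\,dx$ is the Segal-Bargmann transform. *)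

(* Defs.v *)
From Stdlib Require Import Reals Factorial.
From Coquelicot Require Import Coquelicot.
Open Scope R_scope.

Fixpoint hermite (n : nat) (x : R) : R :=
  match n with
  | O => 1
  | S m => match m with
           | O => 2 * x
           | S k => 2 * x * hermite m x - 2 * INR m * hermite k x
           end
  end.

Definition hermite_fun (l : nat) (x : R) : R :=
  / sqrt (2 ^ l * INR (fact l) * sqrt PI) * hermite l x * exp (- x ^ 2 / 2).

Definition cexp (z : C) : C :=
  (exp (Re z) * cos (Im z), exp (Re z) * sin (Im z)).

Definition bargmann (phi : R -> C) (z : C) : C :=
  (RtoC (Rpower PI (-1/4)) *
   @RInt_gen C_R_CompleteNormedModule
     (fun x : R => (cexp (- (z * z + RtoC (x ^ 2)) / 2 + RtoC (sqrt 2) * z * RtoC x)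
                    * phi x)%C)
     (Rbar_locally m_infty) (Rbar_locally p_infty))%C.

Definition Hmod (a : R) (l : nat) (x : R) : C :=
  (RtoC (hermite_fun l x) * cexp (0, a * x)%R)%C.

Definition Phi (a : R) (l : nat) : C -> C :=
  bargmann (fun x => (Hmod a l x / RtoC (sqrt (INR (fact l))))%C).

Definition T_op (a : R) (f : C -> C) (z : C) : C :=
  (C_derive f z - (0, a / sqrt 2)%R * f z)%C.

(* Main.v *)
Require Import Defs.
From Stdlib Require Import Reals Factorial Lra Lia.
From Coquelicot Require Import Coquelicot.
Open Scope R_scope.

(** With [w = sqrt 2 z + i a], the transform is a constant times
    [exp (- z^2 / 2) * I_l], where [I_l] is the integral of [exp (- x^2 + w x) H_l(x)].
    Integrating by parts with [(exp (- x^2) H_l)' = - exp (- x^2) H_{l+1}] gives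
    [I_{l+1} = w I_l], and moving the line of integration gives
    [I_0 = exp (w^2 / 4) L] with [L] the integral of [exp (- x^2)], whose value is irrelevant.
    Hence [Phi_l] is a constant times [w^l exp (i a z / sqrt 2 - a^2 / 4)]; [T_a] only
    differentiates the factor [w^l], and the constants are normalised accordingly. *)

(** * Improper integrals as limits of integrals over segments *)

(** [is_RInt_gen] is a limit along a relation between segments and values. Integrability on every
    segment turns it into the limit of the function [RInt], on which limits can be added and
    compared; the converse is the next lemma. *)
Lemma is_RInt_gen_of_filterlim {V : CompleteNormedModule R_AbsRing}
  {Fa Fb : (R -> Prop) -> Prop} {FFa : Filter Fa} {FFb : Filter Fb} (f : R -> V) (l : V) :
  (forall a b, ex_RInt f a b) ->
  filterlim (fun ab => RInt f (fst ab) (snd ab)) (filter_prod Fa Fb) (locally l) ->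
  is_RInt_gen f Fa Fb l.
Proof.
  intros Hex Hlim P HP.
  specialize (Hlim P HP); unfold filtermap in Hlim; unfold filtermapi.
  revert Hlim; apply filter_imp; intros ab Hab.
  exists (RInt f (fst ab) (snd ab)); split; [apply RInt_correct, Hex | exact Hab].
Qed.

Lemma filterlim_RInt_of_is_RInt_gen {V : CompleteNormedModule R_AbsRing}
  {Fa Fb : (R -> Prop) -> Prop} {FFa : Filter Fa} {FFb : Filter Fb} (f : R -> V) (l : V) :
  is_RInt_gen f Fa Fb l ->
  filterlim (fun ab => RInt f (fst ab) (snd ab)) (filter_prod Fa Fb) (locally l).
Proof.
  intros H P HP.
  specialize (H P HP); unfold filtermapi in H; unfold filtermap.
  revert H; apply filter_imp; intros ab [y [Hy HPy]].
  now rewrite (is_RInt_unique _ _ _ _ Hy).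
Qed.

(** * Convergence of the Gaussian integral *)

Lemma nondecreasing_bounded_filterlim (F : R -> R) (M : R) :
  (forall x y, x <= y -> F x <= F y) -> (forall x, F x <= M) ->
  exists L, filterlim F (Rbar_locally p_infty) (locally L).
Proof.
  intros Hmono HM.
  destruct (completeness (fun y => exists x, y = F x)) as [L [Hub Hlub]].
  - exists M; intros y [x ->]; apply HM.
  - now exists (F 0), 0.
  - exists L; apply filterlim_locally; intros eps.
    assert (Hx : exists x, L - eps < F x).
    { apply Classical_Prop.NNPP; intros Hno.
      assert (L <= L - eps).
      { apply Hlub; intros y [x ->].
        apply Rnot_lt_le; intros Hlt; apply Hno; now exists x. }
      generalize (cond_pos eps); lra. }
    destruct Hx as [x Hx].
    exists x; intros y Hy.
    assert (F x <= F y) by (apply Hmono; lra).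
    assert (F y <= L) by (apply Hub; now exists y).
    change (Rabs (F y - L) < eps); apply Rabs_def1; lra.
Qed.

Lemma exp_neg_le_inv (y : R) : 0 <= y -> exp (- y) <= / (1 + y).
Proof.
  intros Hy.
  rewrite exp_Ropp.
  apply Rinv_le_contravar; [lra | apply exp_ineq1_le].
Qed.

Lemma ex_RInt_gauss (a b : R) : ex_RInt (fun x => exp (- x ^ 2)) a b.
Proof.
  apply (ex_RInt_continuous (V := R_CompleteNormedModule)); intros x _.
  apply (ex_derive_continuous (V := R_NormedModule)); auto_derive; trivial.
Qed.

(** On the right half-line, [exp (- x^2) <= / (1 + x^2)], whose primitive [atan] stays below
    [PI / 2], so the increasing partial integrals converge. Evenness carries the limit to the left
    half-line. *)
Lemma gauss_converges :
  exists L : R, is_RInt_gen (fun x => exp (- x ^ 2)) (Rbar_locally m_infty)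
    (Rbar_locally p_infty) L.
Proof.
  set (g := fun x : R => exp (- x ^ 2)).
  destruct (nondecreasing_bounded_filterlim (fun x => RInt g 0 x) (PI / 2)) as [L HL].
  - intros x y Hxy.
    rewrite <- (RInt_Chasles g 0 x y) by apply ex_RInt_gauss.
    change (plus ?u ?v) with (u + v).
    assert (0 <= RInt g x y).
    { apply RInt_ge_0; [exact Hxy | apply ex_RInt_gauss | intros; apply Rlt_le, exp_pos]. }
    lra.
  - intros x.
    destruct (Rle_or_lt 0 x) as [Hx | Hx].
    + assert (Hat : is_RInt (fun t => / (1 + t ^ 2)) 0 x (atan x - atan 0)).
      { apply (is_RInt_derive atan).
        - intros t _; auto_derive; trivial; field; nra.
        - intros t _; apply (ex_derive_continuous (V := R_NormedModule)).
          auto_derive; nra. }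
      apply Rle_trans with (RInt (fun t => / (1 + t ^ 2)) 0 x).
      * apply RInt_le; trivial.
        -- apply ex_RInt_gauss.
        -- eexists; exact Hat.
        -- intros t _; apply exp_neg_le_inv; nra.
      * rewrite (is_RInt_unique _ _ _ _ Hat), atan_0.
        generalize (atan_bound x); lra.
    (* For negative [x] the oriented integral from 0 to [x] is nonpositive. *)
    + rewrite <- (opp_RInt_swap g x 0) by apply ex_RInt_gauss.
      assert (0 <= RInt g x 0).
      { apply RInt_ge_0; [lra | apply ex_RInt_gauss | intros; apply Rlt_le, exp_pos]. }
      change (opp ?u) with (- u); generalize PI_RGT_0; lra.
  (* Splitting at 0: the integral from 0 to [a] tends to [- L] as [a] goes to minus infinity, and
     enters with a minus sign. *)
  - exists (- - L + L).
    apply (is_RInt_gen_of_filterlim (V := R_CompleteNormedModule)); [apply ex_RInt_gauss |].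
    apply filterlim_ext with (fun ab => - RInt g 0 (fst ab) + RInt g 0 (snd ab)).
    { intros [a b]; simpl.
      rewrite <- (RInt_Chasles g a 0 b) by apply ex_RInt_gauss.
      now rewrite <- (opp_RInt_swap g a 0) by apply ex_RInt_gauss;
        change (plus ?u ?v) with (u + v); change (opp ?u) with (- u); ring_simplify. }
    apply (filterlim_comp_2 (G := locally (- - L)) (H := locally L)
      (fun ab => - RInt g 0 (fst ab)) (fun ab => RInt g 0 (snd ab)) Rplus);
      [ | eapply filterlim_comp; [apply filterlim_snd | exact HL]
        | apply (filterlim_plus (V := R_NormedModule))].
    apply (filterlim_comp _ _ _ fst (fun a => - RInt g 0 a) _ (Rbar_locally m_infty));
      [apply filterlim_fst |].
    apply (filterlim_comp _ _ _ (fun a => RInt g 0 a) Ropp _ (locally (- L)));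
      [| apply (filterlim_opp (V := R_NormedModule))].
    (* Substitution of [- x] for [x], with [g] even. *)
    apply filterlim_ext with (fun a => - RInt g 0 (- a)).
    { intros a.
      assert (H := RInt_correct g 0 (- a) (ex_RInt_gauss _ _)).
      rewrite <- Ropp_0 in H at 1; apply (is_RInt_comp_opp g) in H.
      apply (is_RInt_opp (V := R_NormedModule)) in H.
      symmetry; apply is_RInt_unique; revert H; apply is_RInt_ext.
      intros x _; unfold g; rewrite opp_opp; f_equal; ring. }
    apply (filterlim_comp _ _ _ (fun a => RInt g 0 (- a)) Ropp _ (locally L));
      [| apply (filterlim_opp (V := R_NormedModule))].
    apply (filterlim_comp _ _ _ Ropp (fun a => RInt g 0 a) _ (Rbar_locally p_infty)); trivial.
    apply (filterlim_Rbar_opp m_infty).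
Qed.

(** * Moving the line of integration of the Gaussian *)

Lemma filterlim_gauss_bound (F : R -> R) (K : R) (s : Rbar) :
  s = m_infty \/ s = p_infty ->
  (forall x, Rabs (F x) <= K * exp (- (x ^ 2 / 2))) ->
  filterlim F (Rbar_locally s) (locally 0).
Proof.
  intros Hs HF; apply filterlim_locally; intros eps.
  (* Since [M >= 1], [Rabs x > M] gives [x^2 > M]; and [eps * M / 2] exceeds [Rabs K], which beats
     the bound [Rabs K / (1 + x^2 / 2)]. *)
  set (M := 1 + 2 * Rabs K / eps).
  assert (He := cond_pos eps).
  assert (HM : 1 <= M).
  { unfold M; assert (0 <= 2 * Rabs K / eps); [| lra].
    apply Rdiv_le_0_compat; [generalize (Rabs_pos K); lra | lra]. }
  assert (Hball : forall x, M < Rabs x -> Rabs (F x - 0) < eps).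
  { intros x Hx.
    rewrite Rminus_0_r; eapply Rle_lt_trans; [apply HF |].
    assert (HxM : M < x ^ 2) by (rewrite <- pow2_abs; nra).
    assert (Hexp := exp_neg_le_inv (x ^ 2 / 2) ltac:(nra)).
    apply Rle_lt_trans with (Rabs K * / (1 + x ^ 2 / 2)).
    { assert (0 < exp (- (x ^ 2 / 2))) by apply exp_pos.
      generalize (Rle_abs K) (Rabs_pos K); nra. }
    apply Rmult_lt_reg_r with (1 + x ^ 2 / 2); [nra |].
    rewrite Rmult_assoc, Rinv_l, Rmult_1_r by nra.
    apply Rlt_le_trans with (eps * (M / 2)); [| nra].
    unfold M; field_simplify; lra. }
  destruct Hs as [-> | ->].
  - exists (- M); intros x Hx; apply Hball; rewrite Rabs_left; lra.
  - exists M; intros x Hx; apply Hball; rewrite Rabs_right; lra.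
Qed.

(* Real part of [exp (- (x - t (p + i q))^2 + i c)]: as [t] runs from 0 to 1 the line of
   integration moves, and the phases [c = 0] and [c = - PI / 2] give the real and imaginary
   parts of the Gaussian. *)
Definition shifted_cos (p q c t x : R) : R :=
  exp (- (x - t * p) ^ 2 + (t * q) ^ 2) * cos (2 * (x - t * p) * (t * q) + c).

Definition shifted_sin (p q c t x : R) : R :=
  exp (- (x - t * p) ^ 2 + (t * q) ^ 2) * sin (2 * (x - t * p) * (t * q) + c).

Definition shifted_cos_dt (p q c t x : R) : R :=
  (2 * p * (x - t * p) + 2 * q * (t * q)) * shifted_cos p q c t x
  + (2 * p * (t * q) - 2 * q * (x - t * p)) * shifted_sin p q c t x.

Lemma is_derive_shifted_cos_t (p q c t x : R) :
  is_derive (fun s => shifted_cos p q c s x) t (shifted_cos_dt p q c t x).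
Proof.
  unfold shifted_cos_dt, shifted_cos, shifted_sin; auto_derive; trivial; simpl; unfold Rminus; ring.
Qed.

(* The same derivative as in [t]: by holomorphy, moving the line produces boundary terms only. *)
Lemma is_derive_shifted_x (p q c t x : R) :
  is_derive (fun y => - p * shifted_cos p q c t y + q * shifted_sin p q c t y) x
    (shifted_cos_dt p q c t x).
Proof.
  unfold shifted_cos_dt, shifted_cos, shifted_sin; auto_derive; trivial; simpl; unfold Rminus; ring.
Qed.

Lemma ex_derive_shifted_cos (p q c t x : R) : ex_derive (shifted_cos p q c t) x.
Proof. unfold shifted_cos; auto_derive; trivial. Qed.

Lemma ex_RInt_shifted_cos (p q c t a b : R) : ex_RInt (shifted_cos p q c t) a b.
Proof.
  apply (ex_RInt_continuous (V := R_CompleteNormedModule)); intros x _.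
  apply (ex_derive_continuous (V := R_NormedModule)), ex_derive_shifted_cos.
Qed.

(** Joint continuity in [(t, x)] is what differentiation under the integral sign requires. *)
Lemma continuity_2d_shifted_cos_dt (p q c t x : R) :
  continuity_2d_pt (shifted_cos_dt p q c) t x.
Proof.
  assert (HX : continuity_2d_pt (fun u v => v - u * p) t x).
  { apply continuity_2d_pt_minus; [apply continuity_2d_pt_id2 |].
    apply continuity_2d_pt_mult; [apply continuity_2d_pt_id1 | apply continuity_2d_pt_const]. }
  assert (HY : continuity_2d_pt (fun u v => u * q) t x).
  { apply continuity_2d_pt_mult; [apply continuity_2d_pt_id1 | apply continuity_2d_pt_const]. }
  assert (Hc : forall k f, continuity_2d_pt f t x -> continuity_2d_pt (fun u v => k * f u v) t x).
  { intros k f Hf; apply continuity_2d_pt_mult; [apply continuity_2d_pt_const | exact Hf]. }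
  assert (Hsq : forall f, continuity_2d_pt f t x -> continuity_2d_pt (fun u v => f u v ^ 2) t x).
  { intros f Hf; apply continuity_2d_pt_ext with (fun u v => f u v * f u v).
    - intros; ring.
    - now apply continuity_2d_pt_mult. }
  assert (HE : continuity_2d_pt (fun u v => exp (- (v - u * p) ^ 2 + (u * q) ^ 2)) t x).
  { apply continuity_1d_2d_pt_comp; [apply derivable_continuous_pt, derivable_pt_exp |].
    apply continuity_2d_pt_plus; [apply continuity_2d_pt_opp |]; now apply Hsq. }
  assert (HA : continuity_2d_pt (fun u v => 2 * (v - u * p) * (u * q) + c) t x).
  { apply continuity_2d_pt_plus; [| apply continuity_2d_pt_const].
    apply continuity_2d_pt_mult; trivial; now apply Hc. }
  unfold shifted_cos_dt, shifted_cos, shifted_sin.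
  apply continuity_2d_pt_plus; apply continuity_2d_pt_mult.
  - apply continuity_2d_pt_plus; now apply Hc.
  - apply continuity_2d_pt_mult; trivial.
    apply continuity_1d_2d_pt_comp; trivial; apply continuity_cos.
  - apply continuity_2d_pt_minus; now apply Hc.
  - apply continuity_2d_pt_mult; trivial.
    apply continuity_1d_2d_pt_comp; trivial; apply continuity_sin.
Qed.

(** Differentiating under the integral sign gives the integral of [shifted_cos_dt], which is also an
    [x]-derivative, so only its primitive at the endpoints remains. *)
Lemma is_derive_RInt_shifted_cos (p q c t a b : R) :
  is_derive (fun s => RInt (shifted_cos p q c s) a b) t
    ((- p * shifted_cos p q c t b + q * shifted_sin p q c t b)
     - (- p * shifted_cos p q c t a + q * shifted_sin p q c t a)).
Proof.
  assert (HI : is_RInt (shifted_cos_dt p q c t) a b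
    ((- p * shifted_cos p q c t b + q * shifted_sin p q c t b)
     - (- p * shifted_cos p q c t a + q * shifted_sin p q c t a))).
  { apply (is_RInt_derive (fun y => - p * shifted_cos p q c t y + q * shifted_sin p q c t y)).
    - intros x _; apply is_derive_shifted_x.
    - intros x _; apply (ex_derive_continuous (V := R_NormedModule)).
      unfold shifted_cos_dt, shifted_cos, shifted_sin; auto_derive; trivial. }
  rewrite <- (is_RInt_unique _ _ _ _ HI).
  rewrite (RInt_ext _ (fun x => Derive (fun s => shifted_cos p q c s x) t)).
  2: { intros x _; symmetry; apply is_derive_unique, is_derive_shifted_cos_t. }
  apply (is_derive_RInt_param (fun s x => shifted_cos p q c s x)).
  - apply filter_forall; intros s x _; eexists; apply is_derive_shifted_cos_t.
  - intros x _; apply continuity_2d_pt_ext with (shifted_cos_dt p q c).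
    + intros u v; symmetry; apply is_derive_unique, is_derive_shifted_cos_t.
    + apply continuity_2d_shifted_cos_dt.
  - apply filter_forall; intros s; apply ex_RInt_shifted_cos.
Qed.

Lemma exp_nondecreasing (x y : R) : x <= y -> exp x <= exp y.
Proof. intros [H | ->]; [now apply Rlt_le, exp_increasing | apply Rle_refl]. Qed.

(** The bound is uniform in [t], as needed at the unknown intermediate point of the mean value
    theorem. *)
Lemma shifted_boundary_le (p q c t x : R) : 0 <= t <= 1 ->
  Rabs (- p * shifted_cos p q c t x + q * shifted_sin p q c t x)
  <= (Rabs p + Rabs q) * exp (p ^ 2 + q ^ 2) * exp (- (x ^ 2 / 2)).
Proof.
  intros Ht; unfold shifted_cos, shifted_sin.
  set (E := exp (- (x - t * p) ^ 2 + (t * q) ^ 2)).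
  set (A := 2 * (x - t * p) * (t * q) + c).
  assert (HE : E <= exp (p ^ 2 + q ^ 2) * exp (- (x ^ 2 / 2))).
  { unfold E; rewrite <- exp_plus; apply exp_nondecreasing.
    assert (t ^ 2 <= 1) by nra.
    (* Twice this square is [(x - t p)^2 - x^2 / 2 + t^2 p^2], so half of the Gaussian decay
       survives the shift. *)
    assert (0 <= (x / 2 - t * p) ^ 2) by apply pow2_ge_0.
    assert (t ^ 2 * p ^ 2 <= p ^ 2) by (generalize (pow2_ge_0 p); nra).
    assert (t ^ 2 * q ^ 2 <= q ^ 2) by (generalize (pow2_ge_0 q); nra).
    nra. }
  assert (HE0 : 0 < E) by apply exp_pos.
  assert (Hc : Rabs (cos A) <= 1) by (apply Rabs_le; generalize (COS_bound A); lra).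
  assert (Hs : Rabs (sin A) <= 1) by (apply Rabs_le; generalize (SIN_bound A); lra).
  eapply Rle_trans; [apply Rabs_triang |].
  rewrite !Rabs_mult, Rabs_Ropp, (Rabs_pos_eq E) by lra.
  assert (Hp := Rabs_pos p); assert (Hq := Rabs_pos q).
  assert (Rabs p * (E * Rabs (cos A)) <= Rabs p * E).
  { apply Rmult_le_compat_l; trivial.
    rewrite <- (Rmult_1_r E) at 2; apply Rmult_le_compat_l; lra. }
  assert (Rabs q * (E * Rabs (sin A)) <= Rabs q * E).
  { apply Rmult_le_compat_l; trivial.
    rewrite <- (Rmult_1_r E) at 2; apply Rmult_le_compat_l; lra. }
  rewrite Rmult_assoc.
  eapply Rle_trans; [| apply Rmult_le_compat_l; [lra | exact HE]]; lra.
Qed.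

(** Mean value theorem in [t] on the interval from 0 to 1, each boundary term being bounded
    separately. *)
Lemma RInt_shifted_cos_diff (p q c a b : R) :
  Rabs (RInt (shifted_cos p q c 1) a b - RInt (shifted_cos p q c 0) a b)
  <= (Rabs p + Rabs q) * exp (p ^ 2 + q ^ 2) * exp (- (b ^ 2 / 2))
     + (Rabs p + Rabs q) * exp (p ^ 2 + q ^ 2) * exp (- (a ^ 2 / 2)).
Proof.
  destruct (MVT_gen (fun s => RInt (shifted_cos p q c s) a b) 0 1
    (fun t => (- p * shifted_cos p q c t b + q * shifted_sin p q c t b)
     - (- p * shifted_cos p q c t a + q * shifted_sin p q c t a))) as [t [Ht Heq]].
  - intros t _; exact (is_derive_RInt_shifted_cos p q c t a b).
  - intros t _; apply continuity_pt_filterlim.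
    apply (ex_derive_continuous (V := R_NormedModule)
      (fun s => RInt (shifted_cos p q c s) a b)).
    eexists; exact (is_derive_RInt_shifted_cos p q c t a b).
  - rewrite Rmin_left, Rmax_right in Ht by lra.
    rewrite Heq, Rminus_0_r, Rmult_1_r.
    unfold Rminus at 1; eapply Rle_trans; [apply Rabs_triang |]; rewrite Rabs_Ropp.
    apply Rplus_le_compat; now apply shifted_boundary_le.
Qed.

(** At [t = 0] the integrand is [cos c * exp (- x^2)]. Over a segment, the integrals for [t = 0] and
    [t = 1] differ by terms that vanish as the endpoints go to infinity. *)
Lemma is_RInt_gen_shifted_cos (L p q c : R) :
  is_RInt_gen (fun x => exp (- x ^ 2)) (Rbar_locally m_infty) (Rbar_locally p_infty) L ->
  is_RInt_gen (shifted_cos p q c 1) (Rbar_locally m_infty) (Rbar_locally p_infty) (cos c * L).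
Proof.
  intros HL.
  assert (H0 : is_RInt_gen (shifted_cos p q c 0) (Rbar_locally m_infty)
                 (Rbar_locally p_infty) (cos c * L)).
  { assert (HS := is_RInt_gen_scal (V := R_NormedModule) _ (cos c) _ HL).
    revert HS; apply is_RInt_gen_ext.
    apply filter_forall; intros ab x _; unfold shifted_cos.
    change (scal ?u ?v) with (u * v).
    rewrite Rmult_comm; f_equal; f_equal; ring. }
  apply (filterlim_RInt_of_is_RInt_gen (V := R_CompleteNormedModule)) in H0.
  apply (is_RInt_gen_of_filterlim (V := R_CompleteNormedModule)).
  { intros; apply ex_RInt_shifted_cos. }
  set (K := (Rabs p + Rabs q) * exp (p ^ 2 + q ^ 2)).
  set (B := fun x : R => K * exp (- (x ^ 2 / 2))).
  assert (HK : 0 <= K).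
  { apply Rmult_le_pos; [| apply Rlt_le, exp_pos].
    generalize (Rabs_pos p) (Rabs_pos q); lra. }
  assert (HB : forall s, s = m_infty \/ s = p_infty -> filterlim B (Rbar_locally s) (locally 0)).
  { intros s Hs; apply filterlim_gauss_bound with K; trivial.
    intros x; unfold B; rewrite Rabs_pos_eq; [apply Rle_refl |].
    apply Rmult_le_pos; [exact HK | apply Rlt_le, exp_pos]. }
  assert (Hb := HB p_infty (or_intror eq_refl)); assert (Ha := HB m_infty (or_introl eq_refl)).
  apply filterlim_locally; intros eps.
  assert (He3 : 0 < eps / 3) by (generalize (cond_pos eps); lra).
  set (e3 := mkposreal _ He3).
  assert (H0e := proj1 (filterlim_locally _ _) H0 e3).
  assert (Hae := proj1 (filterlim_locally _ _)
     (filterlim_comp _ _ _ _ _ _ _ _ (filterlim_fst (G := Rbar_locally p_infty)) Ha) e3).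
  assert (Hbe := proj1 (filterlim_locally _ _)
     (filterlim_comp _ _ _ _ _ _ _ _ (filterlim_snd (F := Rbar_locally m_infty)) Hb) e3).
  generalize (filter_and _ _ H0e (filter_and _ _ Hae Hbe)); apply filter_imp.
  intros [a b] [H1 [H2 H3]]; simpl in H1, H2, H3 |- *.
  change (Rabs (RInt (shifted_cos p q c 0) a b - cos c * L) < eps / 3) in H1.
  change (Rabs (B a - 0) < eps / 3) in H2; change (Rabs (B b - 0) < eps / 3) in H3.
  change (Rabs (RInt (shifted_cos p q c 1) a b - cos c * L) < eps).
  assert (H4 := RInt_shifted_cos_diff p q c a b); fold K in H4.
  fold (B a) in H4; fold (B b) in H4.
  apply Rabs_def2 in H1; apply Rabs_def2 in H2; apply Rabs_def2 in H3.
  apply Rabs_le_between in H4.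
  apply Rabs_def1; lra.
Qed.

(** * Complex-valued improper integrals by components *)

Lemma is_RInt_gen_C_pair {Fa Fb : (R -> Prop) -> Prop} {FFa : Filter Fa} {FFb : Filter Fb}
  (f : R -> C) (l : C) :
  is_RInt_gen (fun x => Re (f x)) Fa Fb (Re l) ->
  is_RInt_gen (fun x => Im (f x)) Fa Fb (Im l) ->
  is_RInt_gen (V := C_R_NormedModule) f Fa Fb l.
Proof.
  intros H1 H2 P [eps HP].
  specialize (H1 _ (locally_ball (Re l) eps)); specialize (H2 _ (locally_ball (Im l) eps)).
  unfold filtermapi in *.
  generalize (filter_and _ _ H1 H2); apply filter_imp.
  intros ab [[y1 [Hy1 Hb1]] [y2 [Hy2 Hb2]]].
  exists (y1, y2); split; [now apply (is_RInt_fct_extend_pair f) | apply HP; now split].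
Qed.

Lemma is_RInt_gen_C_Re {Fa Fb : (R -> Prop) -> Prop} {FFa : Filter Fa} {FFb : Filter Fb}
  (f : R -> C) (l : C) :
  is_RInt_gen (V := C_R_NormedModule) f Fa Fb l -> is_RInt_gen (fun x => Re (f x)) Fa Fb (Re l).
Proof.
  intros H P [eps HP].
  specialize (H _ (locally_ball (l : C_R_NormedModule) eps)); unfold filtermapi in *.
  revert H; apply filter_imp; intros ab [y [Hy Hb]].
  exists (Re y); split; [now apply (is_RInt_fct_extend_fst f) | apply HP, Hb].
Qed.

Lemma is_RInt_gen_C_Im {Fa Fb : (R -> Prop) -> Prop} {FFa : Filter Fa} {FFb : Filter Fb}
  (f : R -> C) (l : C) :
  is_RInt_gen (V := C_R_NormedModule) f Fa Fb l -> is_RInt_gen (fun x => Im (f x)) Fa Fb (Im l).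
Proof.
  intros H P [eps HP].
  specialize (H _ (locally_ball (l : C_R_NormedModule) eps)); unfold filtermapi in *.
  revert H; apply filter_imp; intros ab [y [Hy Hb]].
  exists (Im y); split; [now apply (is_RInt_fct_extend_snd f) | apply HP, Hb].
Qed.

Lemma is_RInt_gen_Cmult {Fa Fb : (R -> Prop) -> Prop} {FFa : Filter Fa} {FFb : Filter Fb}
  (f : R -> C) (c l : C) :
  is_RInt_gen (V := C_R_NormedModule) f Fa Fb l ->
  is_RInt_gen (V := C_R_NormedModule) (fun x => Cmult c (f x)) Fa Fb (Cmult c l).
Proof.
  intros H; assert (Hr := is_RInt_gen_C_Re _ _ H); assert (Hi := is_RInt_gen_C_Im _ _ H).
  apply is_RInt_gen_C_pair.
  - apply (is_RInt_gen_minus (V := R_NormedModule)).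
    + apply (is_RInt_gen_scal (V := R_NormedModule)), Hr.
    + apply (is_RInt_gen_scal (V := R_NormedModule)), Hi.
  - apply (is_RInt_gen_plus (V := R_NormedModule)).
    + apply (is_RInt_gen_scal (V := R_NormedModule)), Hi.
    + apply (is_RInt_gen_scal (V := R_NormedModule)), Hr.
Qed.

(** * The Gaussian integral with a complex linear term *)

Lemma cexp_plus (u v : C) : cexp (u + v)%C = (cexp u * cexp v)%C.
Proof.
  destruct u as [a b], v as [c d]; unfold cexp, Cplus, Cmult, Re, Im; simpl.
  rewrite exp_plus, cos_plus, sin_plus; f_equal; ring.
Qed.

Lemma cexp_RtoC (x : R) : cexp (RtoC x) = RtoC (exp x).
Proof. unfold cexp, RtoC, Re, Im; simpl; rewrite cos_0, sin_0; f_equal; ring. Qed.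

(** Completing the square: [- x^2 + w x = w^2 / 4 - (x - w / 2)^2], where [w / 2 = p + i q] is the
    shift of the line. The phases 0 and [- PI / 2] give the integrals [L] and 0 of the real and
    imaginary parts. *)
Lemma is_RInt_gen_gauss_cexp (L : R) (w : C) :
  is_RInt_gen (fun x => exp (- x ^ 2)) (Rbar_locally m_infty) (Rbar_locally p_infty) L ->
  is_RInt_gen (V := C_R_NormedModule) (fun x => cexp (- RtoC (x ^ 2) + w * RtoC x)%C)
    (Rbar_locally m_infty) (Rbar_locally p_infty) (cexp (w * w / 4) * RtoC L)%C.
Proof.
  intros HL.
  set (p := Re w / 2); set (q := Im w / 2).
  assert (H : is_RInt_gen (V := C_R_NormedModule)
    (fun x => (shifted_cos p q 0 1 x, shifted_cos p q (- (PI / 2)) 1 x))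
    (Rbar_locally m_infty) (Rbar_locally p_infty) (RtoC L)).
  { assert (Hc := is_RInt_gen_shifted_cos L p q 0 HL).
    assert (Hs := is_RInt_gen_shifted_cos L p q (- (PI / 2)) HL).
    rewrite cos_0, Rmult_1_l in Hc; rewrite cos_neg, cos_PI2, Rmult_0_l in Hs.
    now apply is_RInt_gen_C_pair. }
  apply (is_RInt_gen_Cmult _ (cexp (w * w / 4)%C)) in H.
  revert H; apply (is_RInt_gen_ext (V := C_R_NormedModule)).
  apply filter_forall; intros ab x _.
  assert (Hs : forall y, cos (y + - (PI / 2)) = sin y).
  { intros y; rewrite cos_plus, cos_neg, sin_neg, cos_PI2, sin_PI2; ring. }
  transitivity (cexp (w * w / 4) * cexp ((- (x - p) ^ 2 + q ^ 2, 2 * (x - p) * q)%R))%C.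
  { f_equal; unfold shifted_cos, cexp; cbn [Re Im fst snd]; rewrite Hs, Rplus_0_r.
    f_equal; f_equal; f_equal; ring. }
  rewrite <- cexp_plus; f_equal.
  unfold p, q; destruct w as [u v]; unfold Cdiv, Cplus, Cmult, Copp, Cinv, RtoC, Re, Im; simpl.
  f_equal; field.
Qed.

(** * Hermite polynomials: derivatives and growth *)

(** For [l = 0] the default [pred 0 = 0] is harmless, because its coefficient [INR 0] vanishes. *)
Lemma hermite_succ (l : nat) (x : R) :
  hermite (S l) x = 2 * x * hermite l x - 2 * INR l * hermite (pred l) x.
Proof. destruct l as [| l]; [simpl; ring | reflexivity]. Qed.

Lemma is_derive_hermite_pred (l : nat) (x : R) :
  is_derive (hermite l) x (2 * INR l * hermite (pred l) x).
Proof.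
  revert x.
  (* The recurrence goes back two steps, so the induction carries two consecutive indices. *)
  enough (H : forall x, is_derive (hermite l) x (2 * INR l * hermite (pred l) x) /\
    is_derive (hermite (S l)) x (2 * INR (S l) * hermite l x)) by apply H.
  induction l as [| l IH]; intros x.
  - split; simpl; auto_derive; trivial; ring.
  - split; [apply IH |].
    assert (Hg : forall (f g : R -> R) (k df dg : R), is_derive f x df -> is_derive g x dg ->
      is_derive (fun y => 2 * y * f y - k * g y) x (2 * f x + 2 * x * df - k * dg)).
    { intros f g k df dg Hf Hg; auto_derive.
      - repeat split; eexists; eassumption.
      - rewrite (is_derive_unique (fun y : R => f y) x _ Hf : Derive (fun y => f y) x = df).
        rewrite (is_derive_unique (fun y : R => g y) x _ Hg : Derive (fun y => g y) x = dg).
        ring. }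
    destruct (IH x) as [H0 H1].
    assert (H := Hg _ _ (2 * INR (S l)) _ _ H1 H0).
    replace (2 * INR (S (S l)) * hermite (S l) x) with
      (2 * hermite (S l) x + 2 * x * (2 * INR (S l) * hermite l x)
       - 2 * INR (S l) * (2 * INR l * hermite (pred l) x)); [exact H |].
    rewrite hermite_succ, !S_INR; ring.
Qed.

(** The form equivalent to [(exp (- x^2) H_l)' = - exp (- x^2) H_{l+1}], ready for integration by
    parts. *)
Lemma is_derive_hermite (l : nat) (x : R) :
  is_derive (hermite l) x (2 * x * hermite l x - hermite (S l) x).
Proof.
  rewrite hermite_succ.
  replace (_ - _) with (2 * INR l * hermite (pred l) x) by ring.
  apply is_derive_hermite_pred.
Qed.

(** An exponential bound suffices against a Gaussian and passes through the recurrence easily: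
    [2 |x| <= 2 exp |x|] raises the rate by one at each step. *)
Lemma hermite_bound (l : nat) :
  exists K, forall x, Rabs (hermite l x) <= K * exp (INR l * Rabs x).
Proof.
  enough (H : (exists K, forall x, Rabs (hermite l x) <= K * exp (INR l * Rabs x)) /\
    (exists K, forall x, Rabs (hermite (S l) x) <= K * exp (INR (S l) * Rabs x))) by apply H.
  assert (Hx : forall x, Rabs (2 * x) <= 2 * exp (Rabs x)).
  { intros x; rewrite Rabs_mult, (Rabs_pos_eq 2) by lra.
    generalize (exp_ineq1_le (Rabs x)); lra. }
  induction l as [| l [[K0 H0] [K1 H1]]].
  - split.
    + exists 1; intros x; simpl; rewrite Rabs_R1, Rmult_0_l, exp_0; lra.
    + exists 2; intros x; simpl hermite; rewrite Rmult_1_l; apply Hx.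
  - split; [now exists K1 |].
    exists (2 * K1 + 2 * INR (S l) * K0); intros x.
    change (hermite (S (S l)) x) with (2 * x * hermite (S l) x - 2 * INR (S l) * hermite l x).
    unfold Rminus; eapply Rle_trans; [apply Rabs_triang |].
    rewrite Rabs_Ropp, !(Rabs_mult _ (hermite _ x)).
    assert (HS : 0 <= INR (S l)) by apply pos_INR.
    rewrite (Rabs_pos_eq (2 * INR (S l))) by lra.
    rewrite Rmult_plus_distr_r; apply Rplus_le_compat.
    + eapply Rle_trans.
      { apply Rmult_le_compat; [apply Rabs_pos | apply Rabs_pos | apply Hx | apply H1]. }
      apply Req_le; rewrite (S_INR (S l)), Rmult_plus_distr_r, Rmult_1_l, exp_plus; ring.
    + rewrite (Rmult_assoc _ K0); apply Rmult_le_compat_l; [lra |].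
      assert (HK0 : 0 <= K0).
      { generalize (Rle_trans _ _ _ (Rabs_pos _) (H0 0)).
        rewrite Rabs_R0, Rmult_0_r, exp_0; lra. }
      eapply Rle_trans; [apply H0 |].
      apply Rmult_le_compat_l; trivial; apply exp_nondecreasing.
      apply Rmult_le_compat_r; [apply Rabs_pos |].
      rewrite !S_INR; lra.
Qed.

Lemma gauss_hermite_bound (l : nat) (u : R) :
  exists K, forall x, exp (- x ^ 2 + u * x) * Rabs (hermite l x) <= K * exp (- (x ^ 2 / 2)).
Proof.
  destruct (hermite_bound l) as [K HK].
  assert (HK0 : 0 <= K).
  { generalize (Rle_trans _ _ _ (Rabs_pos _) (HK 0)).
    rewrite Rabs_R0, Rmult_0_r, exp_0; lra. }
  (* The exponent is at most [- x^2 + m |x|], and [m |x| <= x^2 / 2 + m^2 / 2] because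
     [(|x| - m)^2 >= 0]. *)
  set (m := Rabs u + INR l).
  exists (K * exp (m ^ 2 / 2)); intros x.
  eapply Rle_trans; [apply Rmult_le_compat_l; [apply Rlt_le, exp_pos | apply HK] |].
  rewrite <- Rmult_assoc, (Rmult_comm _ K), !Rmult_assoc, <- !exp_plus.
  apply Rmult_le_compat_l; trivial; apply exp_nondecreasing.
  assert (Hux : u * x <= Rabs u * Rabs x) by (rewrite <- Rabs_mult; apply Rle_abs).
  assert (H := pow2_ge_0 (Rabs x - m)).
  rewrite <- (pow2_abs x); unfold m in *; nra.
Qed.

(** * Integration by parts against Hermite polynomials *)

Lemma is_RInt_gen_derive_vanishing (F dF : R -> R) (K : R) :
  (forall x, is_derive F x (dF x)) -> (forall x, ex_derive dF x) ->
  (forall x, Rabs (F x) <= K * exp (- (x ^ 2 / 2))) ->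
  is_RInt_gen dF (Rbar_locally m_infty) (Rbar_locally p_infty) 0.
Proof.
  intros HF HdF HK.
  assert (HD : forall x, Derive F x = dF x) by (intros; now apply is_derive_unique).
  assert (H : is_RInt_gen (Derive F) (Rbar_locally m_infty) (Rbar_locally p_infty) (0 - 0)).
  { apply is_RInt_gen_Derive.
    - apply filter_forall; intros ab x _; now exists (dF x).
    - apply filter_forall; intros ab x _.
      apply continuous_ext with dF; [now intros |].
      now apply (ex_derive_continuous (V := R_NormedModule)).
    - apply filterlim_gauss_bound with K; auto.
    - apply filterlim_gauss_bound with K; auto. }
  rewrite Rminus_0_r in H; revert H; apply is_RInt_gen_ext.
  apply filter_forall; intros ab x _; apply HD.
Qed.

Local Arguments hermite : simpl never.

(** The derivative of [exp (- x^2 + w x) H_l] is [exp (- x^2 + w x) (w H_l - H_{l+1})], and its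
    integral vanishes by decay at both ends. Subtracting it from [w] times the given integral leaves
    the one for [H_{l+1}]. The functions [fc] and [fs] are the real and imaginary parts. *)
Lemma is_RInt_gen_gauss_hermite_succ (l : nat) (w I : C) :
  is_RInt_gen (V := C_R_NormedModule)
    (fun x => cexp (- RtoC (x ^ 2) + w * RtoC x) * RtoC (hermite l x))%C
    (Rbar_locally m_infty) (Rbar_locally p_infty) I ->
  is_RInt_gen (V := C_R_NormedModule)
    (fun x => cexp (- RtoC (x ^ 2) + w * RtoC x) * RtoC (hermite (S l) x))%C
    (Rbar_locally m_infty) (Rbar_locally p_infty) (w * I)%C.
Proof.
  intros HI; destruct w as [u v].
  set (fc := fun l x => exp (- x ^ 2 + u * x) * cos (v * x) * hermite l x).
  set (fs := fun l x => exp (- x ^ 2 + u * x) * sin (v * x) * hermite l x).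
  assert (Hf : forall l x,
    (cexp (- RtoC (x ^ 2) + (u, v) * RtoC x) * RtoC (hermite l x))%C = (fc l x, fs l x)).
  { intros k x; unfold fc, fs, cexp, Cplus, Cmult, Copp, RtoC, Re, Im; cbn [fst snd].
    replace (- x ^ 2 + (u * x - v * 0)) with (- x ^ 2 + u * x) by ring.
    replace (- 0 + (u * 0 + v * x)) with (v * x) by ring.
    f_equal; ring. }
  assert (Hh : forall l x, ex_derive (fun y => hermite l y) x).
  { intros k x; eexists; apply is_derive_hermite. }
  assert (HD : forall l x, Derive (fun y => hermite l y) x
    = 2 * x * hermite l x - hermite (S l) x).
  { intros k x; apply is_derive_unique, is_derive_hermite. }
  assert (Hbound : forall g, (forall y, Rabs (g y) <= 1) -> exists K, forall x,
    Rabs (exp (- x ^ 2 + u * x) * g x * hermite l x) <= K * exp (- (x ^ 2 / 2))).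
  { intros g Hg; destruct (gauss_hermite_bound l u) as [K HK]; exists K; intros x.
    eapply Rle_trans; [| apply HK].
    rewrite !Rabs_mult, (Rabs_pos_eq (exp _)) by apply Rlt_le, exp_pos.
    apply Rmult_le_compat_r; [apply Rabs_pos |].
    rewrite <- (Rmult_1_r (exp _)) at 2.
    apply Rmult_le_compat_l; [apply Rlt_le, exp_pos | apply Hg]. }
  assert (Hc : is_RInt_gen (fun x => u * fc l x - v * fs l x - fc (S l) x)
    (Rbar_locally m_infty) (Rbar_locally p_infty) 0).
  { destruct (Hbound (fun x => cos (v * x))) as [K HK].
    { intros y; apply Rabs_le; generalize (COS_bound (v * y)); lra. }
    apply is_RInt_gen_derive_vanishing with (fc l) K; [| | exact HK].
    - intros x; unfold fc, fs; auto_derive; [auto |].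
      rewrite HD; simpl pow; ring.
    - intros x; unfold fc, fs; auto_derive; repeat split; auto. }
  assert (Hs : is_RInt_gen (fun x => u * fs l x + v * fc l x - fs (S l) x)
    (Rbar_locally m_infty) (Rbar_locally p_infty) 0).
  { destruct (Hbound (fun x => sin (v * x))) as [K HK].
    { intros y; apply Rabs_le; generalize (SIN_bound (v * y)); lra. }
    apply is_RInt_gen_derive_vanishing with (fs l) K; [| | exact HK].
    - intros x; unfold fc, fs; auto_derive; [auto |].
      rewrite HD; simpl pow; ring.
    - intros x; unfold fc, fs; auto_derive; repeat split; auto. }
  assert (HF : is_RInt_gen (V := C_R_NormedModule) (fun x =>
    (u * fc l x - v * fs l x - fc (S l) x, u * fs l x + v * fc l x - fs (S l) x))
    (Rbar_locally m_infty) (Rbar_locally p_infty) (RtoC 0)).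
  { now apply is_RInt_gen_C_pair. }
  apply (is_RInt_gen_Cmult _ (u, v)) in HI.
  assert (H := is_RInt_gen_minus (V := C_R_NormedModule) _ _ _ _ HI HF).
  (* The value [w I] is written as [w I - 0] to match the difference of the two integrals. *)
  assert (E : ((u, v) * I)%C = minus (G := C_R_NormedModule) ((u, v) * I)%C (RtoC 0)).
  { change (minus ?a ?b) with (Cminus a b); ring. }
  rewrite E; revert H; apply is_RInt_gen_ext; apply filter_forall; intros ab x _.
  rewrite !Hf; change (minus ?a ?b) with (Cminus a b).
  unfold Cminus, Cplus, Cmult, Copp; cbn [fst snd]; f_equal; ring.
Qed.

Lemma is_RInt_gen_gauss_hermite (L : R) (l : nat) (w : C) :
  is_RInt_gen (fun x => exp (- x ^ 2)) (Rbar_locally m_infty) (Rbar_locally p_infty) L ->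
  is_RInt_gen (V := C_R_NormedModule)
    (fun x => cexp (- RtoC (x ^ 2) + w * RtoC x) * RtoC (hermite l x))%C
    (Rbar_locally m_infty) (Rbar_locally p_infty) (w ^ l * (cexp (w * w / 4) * RtoC L))%C.
Proof.
  intros HL; induction l as [| l IH].
  - simpl Cpow; rewrite Cmult_1_l.
    generalize (is_RInt_gen_gauss_cexp L w HL).
    apply (is_RInt_gen_ext (V := C_R_NormedModule)); apply filter_forall; intros ab x _.
    now rewrite Cmult_1_r.
  - rewrite Cpow_S, <- Cmult_assoc; now apply is_RInt_gen_gauss_hermite_succ.
Qed.

(** * Complex differentiability of the exponential and of powers *)

Lemma derivable_pt_lim_0_taylor (f : R -> R) (l eps : R) :
  derivable_pt_lim f 0 l -> 0 < eps ->
  exists d : posreal, forall h, Rabs h < d -> Rabs (f h - f 0 - l * h) <= eps * Rabs h.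
Proof.
  intros Hf Heps; destruct (Hf eps Heps) as [d Hd]; exists d; intros h Hh.
  destruct (Req_dec h 0) as [-> | Hh0].
  - rewrite Rabs_R0, Rmult_0_r, Rmult_0_r, !Rminus_eq_0, Rabs_R0; lra.
  - specialize (Hd h Hh0 Hh); rewrite Rplus_0_l in Hd.
    replace (f h - f 0 - l * h) with (((f h - f 0) / h - l) * h) by (field; trivial).
    rewrite Rabs_mult; apply Rmult_le_compat_r; [apply Rabs_pos | lra].
Qed.

(** First-order expansion at 0, assembled from those of [exp], [sin] and [cos]; the functional
    equation later moves it to any point. *)
Lemma cexp_taylor (eps : R) : 0 < eps ->
  exists d : posreal, forall h : C, Cmod h < d -> Cmod (cexp h - 1 - h)%C <= eps * Cmod h.
Proof.
  (* Each component of the remainder is at most [5 e |h|], and passing to the modulus costs a factor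
     [sqrt 2 <= 2], hence the 10. *)
  intros Heps; set (e := Rmin 1 (eps / 10)).
  assert (He : 0 < e) by (apply Rmin_glb_lt; lra).
  assert (He1 : e <= 1) by apply Rmin_l.
  assert (He2 : e <= eps / 10) by apply Rmin_r.
  clearbody e.
  destruct (derivable_pt_lim_0_taylor exp 1 e derivable_pt_lim_exp_0 He) as [d1 H1].
  assert (Hs := derivable_pt_lim_sin 0); rewrite cos_0 in Hs.
  assert (Hc := derivable_pt_lim_cos 0); rewrite sin_0, Ropp_0 in Hc.
  destruct (derivable_pt_lim_0_taylor sin 1 e Hs He) as [d2 H2].
  destruct (derivable_pt_lim_0_taylor cos 0 e Hc He) as [d3 H3].
  (* Including [e] in the radius yields [|exp s - 1| <= 2 e], which controls the cross terms. *)
  assert (Hd : 0 < Rmin (Rmin d1 d2) (Rmin d3 e)).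
  { repeat apply Rmin_glb_lt; trivial; apply cond_pos. }
  exists (mkposreal _ Hd); intros [s t] Hh; simpl pos in Hh.
  assert (Hst := Rmax_Cmod (s, t)); simpl fst in Hst; simpl snd in Hst.
  set (m := Cmod (s, t)) in *.
  assert (Hsm : Rabs s <= m) by (eapply Rle_trans; [apply Rmax_l | exact Hst]).
  assert (Htm : Rabs t <= m) by (eapply Rle_trans; [apply Rmax_r | exact Hst]).
  assert (Hmin1 := Rmin_l (Rmin d1 d2) (Rmin d3 e)).
  assert (Hmin2 := Rmin_r (Rmin d1 d2) (Rmin d3 e)).
  assert (Hmin3 := Rmin_l d1 d2); assert (Hmin4 := Rmin_r d1 d2).
  assert (Hmin5 := Rmin_l d3 e); assert (Hmin6 := Rmin_r d3 e).
  specialize (H1 s ltac:(lra)); specialize (H2 t ltac:(lra)); specialize (H3 t ltac:(lra)).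
  rewrite exp_0, Rmult_1_l in H1; rewrite sin_0, Rmult_1_l, Rminus_0_r in H2.
  rewrite cos_0, Rmult_0_l, Rminus_0_r in H3.
  assert (Hm : 0 <= m) by apply Cmod_ge_0.
  assert (H1' : Rabs (exp s - 1 - s) <= e * m) by nra.
  assert (H2' : Rabs (sin t - t) <= e * m) by nra.
  assert (H3' : Rabs (cos t - 1) <= e * m) by nra.
  assert (H4 : Rabs (exp s - 1) <= 2 * e).
  { replace (exp s - 1) with ((exp s - 1 - s) + s) by ring.
    eapply Rle_trans; [apply Rabs_triang |]; nra. }
  assert (Hexp : 0 < exp s <= 3).
  { split; [apply exp_pos |]; apply Rabs_le_between in H4; lra. }
  assert (HRe : Rabs (exp s * cos t - 1 - s) <= 5 * (e * m)).
  { replace (exp s * cos t - 1 - s) with (exp s * (cos t - 1) + (exp s - 1 - s)) by ring.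
    eapply Rle_trans; [apply Rabs_triang |].
    rewrite Rabs_mult, (Rabs_pos_eq (exp s)) by lra.
    assert (exp s * Rabs (cos t - 1) <= 3 * (e * m)).
    { apply Rmult_le_compat; try lra; apply Rabs_pos. }
    nra. }
  assert (HIm : Rabs (exp s * sin t - t) <= 5 * (e * m)).
  { replace (exp s * sin t - t) with (exp s * (sin t - t) + (exp s - 1) * t) by ring.
    eapply Rle_trans; [apply Rabs_triang |].
    rewrite !Rabs_mult, (Rabs_pos_eq (exp s)) by lra.
    assert (exp s * Rabs (sin t - t) <= 3 * (e * m)).
    { apply Rmult_le_compat; try lra; apply Rabs_pos. }
    assert (Rabs (exp s - 1) * Rabs t <= 2 * e * m).
    { apply Rmult_le_compat; try lra; apply Rabs_pos. }
    lra. }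
  replace (cexp (s, t) - 1 - (s, t))%C with (exp s * cos t - 1 - s, exp s * sin t - t).
  2: { unfold cexp, Cminus, Cplus, Copp, RtoC, Re, Im; simpl; f_equal; ring. }
  eapply Rle_trans; [apply Cmod_2Rmax |]; simpl fst; simpl snd.
  assert (Hs2 : sqrt 2 <= 2).
  { rewrite <- (sqrt_square 2) at 2 by lra; apply sqrt_le_1; lra. }
  apply Rle_trans with (2 * (5 * (e * m))).
  - apply Rmult_le_compat; trivial; [apply sqrt_pos | | now apply Rmax_lub].
    eapply Rle_trans; [apply Rabs_pos | apply Rmax_l].
  - nra.
Qed.

Lemma is_derive_cexp (z : C) : is_derive (V := AbsRing_NormedModule C_AbsRing) cexp z (cexp z).
Proof.
  split; [apply is_linear_scal_l |].
  intros z' Hz'; apply (is_filter_lim_locally_unique (V := AbsRing_NormedModule C_AbsRing)) in Hz'.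
  rewrite <- Hz'; clear z' Hz'; intros eps.
  assert (HM := Cmod_ge_0 (cexp z)).
  (* The remainder at [z] is [cexp z] times the remainder at 0; the added 1 keeps the denominator
     positive. *)
  assert (He : 0 < eps / (1 + Cmod (cexp z))).
  { apply Rdiv_lt_0_compat; [apply cond_pos | lra]. }
  destruct (cexp_taylor _ He) as [d Hd].
  exists d; intros y Hy.
  change (Cmod (y - z) < d)%C in Hy.
  change (Cmod (cexp y - cexp z - (y - z) * cexp z)%C <= eps * Cmod (y - z)%C).
  specialize (Hd _ Hy).
  replace (cexp y) with (cexp z * cexp (y - z))%C by (rewrite <- cexp_plus; f_equal; ring).
  replace (cexp z * cexp (y - z) - cexp z - (y - z) * cexp z)%C
    with (cexp z * (cexp (y - z) - 1 - (y - z)))%C by ring.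
  rewrite Cmod_mult.
  eapply Rle_trans; [apply Rmult_le_compat_l; [exact HM | exact Hd] |].
  rewrite <- Rmult_assoc; apply Rmult_le_compat_r; [apply Cmod_ge_0 |].
  assert (Hq : eps / (1 + Cmod (cexp z)) * (1 + Cmod (cexp z)) = eps) by (field; lra).
  nra.
Qed.

(* [C_NormedModule] and [AbsRing_NormedModule C_AbsRing] carry the same norm but
   differently presented uniform structures, so [is_derive] has to be transported. *)
Lemma is_derive_C_NormedModule (f : C -> C) (z l : C) :
  is_derive (V := AbsRing_NormedModule C_AbsRing) f z l ->
  is_derive (V := C_NormedModule) f z l.
Proof. intros [_ H]; split; [apply is_linear_scal_l | exact H]. Qed.

Lemma is_derive_C_affine (a b z : C) :
  is_derive (V := AbsRing_NormedModule C_AbsRing) (fun y => a * y + b)%C z a.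
Proof.
  split; [apply is_linear_scal_l |].
  intros z' Hz' eps; apply filter_forall; intros y.
  change (Cmod ((a * y + b) - (a * z' + b) - (y - z') * a)%C <= eps * Cmod (y - z')%C).
  replace ((a * y + b) - (a * z' + b) - (y - z') * a)%C with (RtoC 0) by ring.
  rewrite Cmod_0; apply Rmult_le_pos; [apply Rlt_le, cond_pos | apply Cmod_ge_0].
Qed.

(** The exponent [S n] avoids a truncated predecessor in the derivative. *)
Lemma is_derive_C_affine_pow (a b z : C) (n : nat) :
  is_derive (V := AbsRing_NormedModule C_AbsRing) (fun y => (a * y + b) ^ S n)%C z
    (RtoC (INR (S n)) * a * (a * z + b) ^ n)%C.
Proof.
  induction n as [| n IH].
  - apply (is_derive_ext (V := AbsRing_NormedModule C_AbsRing) (fun y => a * y + b)%C);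
      [intros y; simpl; ring |].
    replace (_ * _ * _)%C with a by (simpl; ring); apply is_derive_C_affine.
  - assert (H := is_derive_mult _ _ _ _ _ (is_derive_C_affine a b z) IH Cmult_comm).
    replace (RtoC (INR (S (S n))) * a * (a * z + b) ^ S n)%C
      with (a * (a * z + b) ^ S n
            + (a * z + b) * (RtoC (INR (S n)) * a * (a * z + b) ^ n))%C; [exact H |].
    rewrite (S_INR (S n)), RtoC_plus, (Cpow_S _ n); ring.
Qed.

(** * Normalising constants and the closed form of the transform *)

(** The constant of [h_l] together with the extra [1 / sqrt (l!)]; it equals
    [1 / (l! sqrt (2^l sqrt PI))]. *)
Definition norm_const (l : nat) : R :=
  / sqrt (2 ^ l * INR (fact l) * sqrt PI) / sqrt (INR (fact l)).

(** The factor [(l + 1) sqrt 2] is the one produced by differentiating [(sqrt 2 z + i a)^(l+1)]. *)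
Lemma norm_const_succ (l : nat) : norm_const (S l) * (INR (S l) * sqrt 2) = norm_const l.
Proof.
  unfold norm_const.
  assert (HF : 0 < INR (fact l)) by apply lt_0_INR, lt_O_fact.
  assert (HS : 0 < INR (S l)) by (apply lt_0_INR; lia).
  assert (Hpi : 0 < sqrt PI) by apply sqrt_lt_R0, PI_RGT_0.
  assert (H2l : 0 < 2 ^ l) by (apply pow_lt; lra).
  rewrite fact_simpl, mult_INR.
  replace (2 ^ S l * (INR (S l) * INR (fact l)) * sqrt PI)
    with ((2 * INR (S l)) * (2 ^ l * INR (fact l) * sqrt PI)) by (simpl pow; ring).
  assert (HP : 0 < 2 ^ l * INR (fact l) * sqrt PI) by (repeat apply Rmult_lt_0_compat; trivial).
  set (P := 2 ^ l * INR (fact l) * sqrt PI) in *; clearbody P.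
  rewrite !sqrt_mult_alt by lra.
  assert (0 < sqrt (INR (S l))) by now apply sqrt_lt_R0.
  assert (0 < sqrt (INR (fact l))) by now apply sqrt_lt_R0.
  assert (0 < sqrt 2) by (apply sqrt_lt_R0; lra).
  assert (0 < sqrt P) by now apply sqrt_lt_R0.
  rewrite <- (sqrt_sqrt (INR (S l))) at 3 by lra.
  field; repeat split; lra.
Qed.

(** The prefactor [exp (- z^2 / 2)] cancels the [z^2 / 2] in [w^2 / 4], so the exponent left is
    affine in [z], with slope [i a / sqrt 2]. *)
Lemma Phi_closed_form (L a : R) (l : nat) (z : C) :
  is_RInt_gen (fun x => exp (- x ^ 2)) (Rbar_locally m_infty) (Rbar_locally p_infty) L ->
  Phi a l z = (RtoC (Rpower PI (-1/4) * norm_const l * L)%R *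
    ((RtoC (sqrt 2) * z + (0, a)) ^ l
     * cexp ((0, a / sqrt 2)%R * z + RtoC (- a ^ 2 / 4)%R)))%C.
Proof.
  intros HL; unfold Phi, bargmann.
  set (w := (RtoC (sqrt 2) * z + (0, a))%C).
  set (k := (RtoC (norm_const l) * cexp (- (z * z) / 2))%C).
  assert (H := is_RInt_gen_Cmult _ k _ (is_RInt_gen_gauss_hermite L l w HL)).
  assert (Hs2 : sqrt 2 * sqrt 2 = 2) by (apply sqrt_sqrt; lra).
  assert (Hs20 : 0 < sqrt 2) by (apply sqrt_lt_R0; lra).
  assert (Hf0 : sqrt (INR (fact l)) <> 0).
  { apply Rgt_not_eq, sqrt_lt_R0, lt_0_INR, lt_O_fact. }
  rewrite (is_RInt_gen_unique (V := C_R_CompleteNormedModule) _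
    (k * (w ^ l * (cexp (w * w / 4) * RtoC L)))%C).
  - replace (cexp ((0, a / sqrt 2)%R * z + RtoC (- a ^ 2 / 4)%R))%C
      with (cexp (- (z * z) / 2) * cexp (w * w / 4))%C.
    { unfold k; rewrite !RtoC_mult; ring. }
    rewrite <- cexp_plus; f_equal; unfold w.
    replace (0, a / sqrt 2)%R with ((0, a) * RtoC (sqrt 2) / 2)%C.
    2: { unfold Cdiv, Cinv, Cmult, RtoC; simpl; f_equal; [field |].
         apply Rmult_eq_reg_r with (2 * sqrt 2); [| lra].
         transitivity (a * (sqrt 2 * sqrt 2)); [field | rewrite Hs2; field]; lra. }
    replace (RtoC (- a ^ 2 / 4)) with ((0, a) * (0, a) / 4)%C.
    2: { unfold Cdiv, Cinv, Cmult, RtoC; simpl; f_equal; field. }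
    transitivity (- (z * z) / 2 + RtoC (sqrt 2) * RtoC (sqrt 2) * (z * z) / 4
      + (0, a) * RtoC (sqrt 2) / 2 * z + (0, a) * (0, a) / 4)%C.
    + field.
    + rewrite <- RtoC_mult, Hs2; field.
  - revert H; apply (is_RInt_gen_ext (V := C_R_NormedModule)).
    apply filter_forall; intros ab x _.
    change (@eq _ ?u ?v) with (@eq C u v).
    unfold Hmod, hermite_fun, k, norm_const, Rdiv.
    rewrite !RtoC_mult, <- (cexp_RtoC (- x ^ 2 * / 2)%R).
    rewrite (RtoC_inv (sqrt (INR (fact l)))) by trivial; unfold Cdiv.
    replace (cexp (- (z * z + RtoC (x ^ 2)%R) * / 2 + RtoC (sqrt 2) * z * RtoC x))%C
      with (cexp (- (z * z) * / 2) * cexp (RtoC (- x ^ 2 * / 2)%R + RtoC (sqrt 2) * z * RtoC x))%C.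
    2: { rewrite <- cexp_plus; f_equal; rewrite RtoC_mult, RtoC_opp, RtoC_inv by lra; ring. }
    (* One half of [- x^2] comes from the kernel and the other from the Hermite function; likewise
       [w x] splits into [sqrt 2 z x] and the modulation [i a x]. *)
    replace (- RtoC (x ^ 2)%R + w * RtoC x)%C
      with ((RtoC (- x ^ 2 * / 2)%R + RtoC (sqrt 2) * z * RtoC x)
            + (RtoC (- x ^ 2 * / 2)%R + (0, a * x)%R))%C.
    2: { unfold w; replace (0, a * x)%R with ((0, a) * RtoC x)%C.
         - rewrite RtoC_mult, RtoC_opp, RtoC_inv by lra; field.
         - unfold Cmult, RtoC; simpl; f_equal; ring. }
    rewrite !cexp_plus; ring.
Qed.

(** * The Appell relation *)

(** [C_derive] is a total function, so differentiability is asserted too: the derivative in [T_op]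
    is then a genuine one. *)
Theorem theorem3p26 (a : R) (ha : 1 < a) (l : nat) (hl : (1 <= l)%nat) (z : C) :
  ex_derive (Phi a l) z /\ T_op a (Phi a l) z = Phi a (l - 1) z.
Proof.
  destruct gauss_converges as [L HL].
  destruct l as [| n]; [lia |].
  replace (S n - 1)%nat with n by lia.
  set (b := (0, a / sqrt 2)%R); set (c := RtoC (- a ^ 2 / 4)%R).
  set (w := (RtoC (sqrt 2) * z + (0, a))%C).
  set (K := RtoC (Rpower PI (-1/4) * norm_const (S n) * L)).
  (* Product rule on the closed form. The second summand is [b] times the function itself, exactly
     what [T_op] subtracts. *)
  assert (HD : is_derive (V := C_NormedModule) (Phi a (S n)) z
    (K * (RtoC (INR (S n)) * RtoC (sqrt 2) * w ^ n * cexp (b * z + c)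
          + w ^ S n * (b * cexp (b * z + c))))%C).
  { apply is_derive_ext with (fun y => K * ((RtoC (sqrt 2) * y + (0, a)) ^ S n
      * cexp (b * y + c)))%C.
    { intros y; symmetry; now apply Phi_closed_form. }
    assert (He := is_derive_comp (V := AbsRing_NormedModule C_AbsRing) cexp
      (fun y => b * y + c)%C z _ _ (is_derive_cexp (b * z + c)%C) (is_derive_C_affine b c z)).
    assert (Hp := is_derive_mult _ _ _ _ _
      (is_derive_C_affine_pow (RtoC (sqrt 2)) (0, a) z n) He Cmult_comm).
    assert (Hk := is_derive_mult _ _ _ _ _ (is_derive_const (V := AbsRing_NormedModule C_AbsRing) K z) Hp Cmult_comm).
    change (is_derive (V := AbsRing_NormedModule C_AbsRing)
      (fun y => K * ((RtoC (sqrt 2) * y + (0, a)) ^ S n * cexp (b * y + c)))%C z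
      (0 * ((RtoC (sqrt 2) * z + (0, a)) ^ S n * cexp (b * z + c))
       + K * (RtoC (INR (S n)) * RtoC (sqrt 2) * w ^ n * cexp (b * z + c)
          + w ^ S n * (b * cexp (b * z + c))))%C) in Hk.
    rewrite Cmult_0_l, Cplus_0_l in Hk; exact (is_derive_C_NormedModule _ _ _ Hk). }
  split; [eexists; exact HD |].
  unfold T_op; rewrite (is_C_derive_unique _ _ _ HD), !(Phi_closed_form L a _ z HL).
  fold b c w K; rewrite <- (norm_const_succ n).
  unfold K; rewrite !RtoC_mult; ring.
Qed.
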